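(* Let $\mathcal C_0$ be a small connected category such that the reduced homology $\widetilde H_*(N\mathcal C_0;\mathbb Z)$ of its nerve is non-trivial (for example, the group of integers regarded as a category with one object). Let $\mathcal C_1$ be the category obtained from $\mathcal C_0$ by adjoining a disjoint initial object $0$, let $\mathcal C_2$ be the category obtained from $\mathcal C_0$ by adjoining a disjoint terminal object $1$, and let $\mathcal C$ be the pushout in the category of small categories of the (injective) inclusions $F_1\colon\mathcal C_0\to\mathcal C_1$ and $F_2\colon\mathcal C_0\to\mathcal C_2$. Let $M=\underline{\mathbb Z}\colon\mathcal C\to\mathsf{Ab}$ be the constant functor with value $\mathbb Z$, and write $M$ also for its restrictions to $\mathcal C_0,\mathcal C_1,\mathcal C_2$. Then there is no exact Mayer--Vietoris sequence associated with this pushout square and $M$; that is, there are no homomorphisms $\partial$ for which the sequence $$\cdots\to\operatorname{colim}^{\mathcal C}_{n+1}M\xrightarrow{\partial}\operatorname{colim}^{\mathcal C_0}_nM\to\operatorname{colim}^{\mathcal C_1}_nM\oplus\operatorname{colim}^{\mathcal C_2}_nM\to\operatorname{colim}^{\mathcal C}_nM\xrightarrow{\partial}\operatorname{colim}^{\mathcal C_0}_{n-1}M\to\cdots,$$ whose maps other than $\partial$ are induced by the functors of the square (with the usual sign on one component), is exact. In particular, the claim that every pushout square of categories with all functors involved injective has an exact Mayer--Vietoris sequence of derived colimits is false.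
   Context: $\operatorname{colim}^{\mathcal C}_n=L_n\operatorname{colim}^{\mathcal C}$ denotes the $n$-th left derived functor of $\operatorname{colim}^{\mathcal C}\colon[\mathcal C,\mathsf{Ab}]\to\mathsf{Ab}$ (zero for $n<0$). A functor $F\colon\mathcal D\to\mathcal C$ induces natural maps $\operatorname{colim}^{\mathcal D}_nF^*M\to\operatorname{colim}^{\mathcal C}_nM$, where $F^*M=M\circ F$. $N$ denotes the nerve. Adjoining a disjoint initial object $0$ to $\mathcal C_0$ means adding a new object $0$, its identity, and exactly one morphism from $0$ to each object of $\mathcal C_0$, with no morphisms from objects of $\mathcal C_0$ to $0$; adjoining a disjoint terminal object is dual. *)

(* Defs.v *)
(* Abelian groups are [zmodType]s. These carry a choice structure, which any *)
(* type has classically ([{classic _}]), so no group is excluded.           *)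
From HB Require Import structures.
From Stdlib Require Import Relations.Relation_Operators.
From mathcomp Require Import all_boot all_order all_algebra.
From mathcomp Require Import all_classical.
From mathcomp.multinomials Require Import freeg.

Set Implicit Arguments.
Unset Strict Implicit.
Unset Printing Implicit Defensive.

Import GRing.Theory.
Local Open Scope ring_scope.

Record smallcat := SmallCat {
  ob :> Type;
  hom : ob -> ob -> Type;
  idm : forall a, hom a a;
  compm : forall a b c, hom b c -> hom a b -> hom a c;
  comp_idl : forall a b (f : hom a b), compm (idm b) f = f;
  comp_idr : forall a b (f : hom a b), compm f (idm a) = f;
  comp_assoc : forall a b c d (h : hom c d) (g : hom b c) (f : hom a b),
    compm h (compm g f) = compm (compm h g) f }.

Arguments hom {s} a b.
Arguments idm {s} a.
Arguments compm {s a b c} g f.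

Record functor (C D : smallcat) := Functor {
  fob :> C -> D;
  fhom : forall a b, hom a b -> hom (fob a) (fob b);
  fhom_id : forall a, fhom (idm a) = idm (fob a);
  fhom_comp : forall a b c (g : hom b c) (f : hom a b),
    fhom (compm g f) = compm (fhom g) (fhom f) }.

Arguments fhom {C D} F {a b} f : rename.

Section FunctorComposition.
Variables (C D E : smallcat) (G : functor D E) (F : functor C D).

Lemma compF_id a : fhom G (fhom F (idm a)) = idm (G (F a)).
Proof. by rewrite !fhom_id. Qed.

Lemma compF_comp a b c (g : hom b c) (f : hom a b) :
  fhom G (fhom F (compm g f)) = compm (fhom G (fhom F g)) (fhom G (fhom F f)).
Proof. by rewrite !fhom_comp. Qed.

Definition compF : functor C E :=
  @Functor C E (fun a => G (F a)) (fun a b f => fhom G (fhom F f))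
    compF_id compF_comp.
End FunctorComposition.

(* Injectivity on objects and on hom-sets, that is, on the set of all arrows. *)
Definition injective_functor (C D : smallcat) (F : functor C D) : Prop :=
  injective F /\ forall a b, injective (@fhom C D F a b).

Definition connected (C : smallcat) : Prop :=
  inhabited C /\
  forall a b : C, clos_refl_sym_trans C (fun x y => inhabited (hom x y)) a b.

Record is_pushout (C0 C1 C2 C : smallcat)
    (F1 : functor C0 C1) (F2 : functor C0 C2)
    (J1 : functor C1 C) (J2 : functor C2 C) : Prop := IsPushout {
  pushout_comm : compF J1 F1 = compF J2 F2;
  pushout_univ : forall (D : smallcat) (G1 : functor C1 D) (G2 : functor C2 D),
    compF G1 F1 = compF G2 F2 ->
    exists! H : functor C D, compF H J1 = G1 /\ compF H J2 = G2 }.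

(* The new object is [None]. *)
Section AdjoinInitial.
Variable C : smallcat.

Definition initial_hom (a b : option C) : Type :=
  match a, b with
  | None, _ => unit
  | Some _, None => Empty_set
  | Some x, Some y => hom x y
  end.

Definition initial_id (a : option C) : initial_hom a a :=
  match a with None => tt | Some x => idm x end.

Definition initial_comp (a b c : option C) :
    initial_hom b c -> initial_hom a b -> initial_hom a c :=
  match a, b, c with
  | None, _, _ => fun _ _ => tt
  | Some _, None, _ => fun _ f => match f with end
  | Some _, Some _, None => fun g _ => match g with end
  | Some _, Some _, Some _ => fun g f => compm g f
  end.

Lemma initial_idl a b (f : initial_hom a b) :
  initial_comp (initial_id b) f = f.
Proof. by case: a b f => [a|] [b|] //=; [exact: comp_idl | case | case]. Qed.

Lemma initial_idr a b (f : initial_hom a b) :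
  initial_comp f (initial_id a) = f.
Proof. by case: a b f => [a|] [b|] //=; [exact: comp_idr | case | case]. Qed.

Lemma initial_assoc a b c d (h : initial_hom c d) (g : initial_hom b c)
    (f : initial_hom a b) :
  initial_comp h (initial_comp g f) = initial_comp (initial_comp h g) f.
Proof.
case: a b c d h g f => [a|] [b|] [c|] [d|] //=; try by [case | move=> ? []].
exact: comp_assoc.
Qed.

Definition add_initial : smallcat :=
  SmallCat initial_idl initial_idr initial_assoc.

Definition initial_incl : functor C add_initial :=
  @Functor C add_initial (@Some C) (fun a b f => f)
    (fun a => erefl) (fun a b c g f => erefl).
End AdjoinInitial.

Section AdjoinTerminal.
Variable C : smallcat.

Definition terminal_hom (a b : option C) : Type :=
  match a, b with
  | _, None => unit
  | None, Some _ => Empty_set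
  | Some x, Some y => hom x y
  end.

Definition terminal_id (a : option C) : terminal_hom a a :=
  match a with None => tt | Some x => idm x end.

Definition terminal_comp (a b c : option C) :
    terminal_hom b c -> terminal_hom a b -> terminal_hom a c :=
  match a, b, c
    return terminal_hom b c -> terminal_hom a b -> terminal_hom a c with
  | _, _, None => fun _ _ => tt
  | _, None, Some _ => fun g _ => match g with end
  | None, Some _, Some _ => fun _ f => match f with end
  | Some _, Some _, Some _ => fun g f => compm g f
  end.

Lemma terminal_idl a b (f : terminal_hom a b) :
  terminal_comp (terminal_id b) f = f.
Proof. by case: a b f => [a|] [b|] //=; [exact: comp_idl | case | case]. Qed.

Lemma terminal_idr a b (f : terminal_hom a b) :
  terminal_comp f (terminal_id a) = f.
Proof. by case: a b f => [a|] [b|] //=; [exact: comp_idr | case | case]. Qed.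

Lemma terminal_assoc a b c d (h : terminal_hom c d) (g : terminal_hom b c)
    (f : terminal_hom a b) :
  terminal_comp h (terminal_comp g f) = terminal_comp (terminal_comp h g) f.
Proof.
case: a b c d h g f => [a|] [b|] [c|] [d|] //=; try by [case | move=> ? []].
exact: comp_assoc.
Qed.

Definition add_terminal : smallcat :=
  SmallCat terminal_idl terminal_idr terminal_assoc.

Definition terminal_incl : functor C add_terminal :=
  @Functor C add_terminal (@Some C) (fun a b f => f)
    (fun a => erefl) (fun a b c g f => erefl).
End AdjoinTerminal.

(* The additive group of the integers as a category with one object. *)
Definition int_cat : smallcat :=
  @SmallCat unit (fun _ _ => int) (fun _ => 0) (fun _ _ _ g f => g + f)
    (fun _ _ => @add0r int) (fun _ _ => @addr0 int) (fun _ _ _ _ => @addrA int).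

Section MakeStructures.
Variables U V : zmodType.

Definition mk_additive (f : U -> V) (fD : zmod_morphism f) : {additive U -> V} :=
  HB.pack f (GRing.isZmodMorphism.Build U V f fD).

Definition mk_subgroup (S : {pred V}) (SB : GRing.zmod_closed S) : zmodClosed V :=
  HB.pack (S : V -> bool) (GRing.isZmodClosed.Build V S SB).
End MakeStructures.

Section Kernel.
Variables (U V : zmodType) (f : {additive U -> V}).

Definition kernel_pred : {pred U} := fun x => f x == 0.

Lemma kernel_closed : GRing.zmod_closed kernel_pred.
Proof.
split=> [|x y]; rewrite !unfold_in /= ?raddf0 // => /eqP fx /eqP fy.
by rewrite raddfB fx fy subrr.
Qed.

HB.instance Definition _ := GRing.isZmodClosed.Build U kernel_pred kernel_closed.

Record kernel := Kernel { kernel_val : U; kernelP : kernel_pred kernel_val }.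

HB.instance Definition _ := [isSub for kernel_val].
HB.instance Definition _ := [Choice of kernel by <:].
HB.instance Definition _ := [SubChoice_isSubZmodule of kernel by <:].

Lemma kernel_val_zmod : zmod_morphism kernel_val.
Proof. exact: (raddfB (val : {additive kernel -> U})). Qed.

Definition kernel_incl : {additive kernel -> U} := mk_additive kernel_val_zmod.

Lemma kernel_eq0 (x : kernel) : f (kernel_val x) = 0.
Proof. by apply/eqP; exact: kernelP. Qed.

Definition mk_kernel (x : U) (fx : f x = 0) : kernel := Kernel (introT eqP fx).
End Kernel.

Section KernelMap.
Variables (U V U' V' : zmodType).
Variables (f : {additive U -> V}) (f' : {additive U' -> V'}).
Variables (g : {additive U -> U'}) (fg : forall x, f x = 0 -> f' (g x) = 0).

Definition kernel_fun (x : kernel f) : kernel f' := mk_kernel (fg (kernel_eq0 x)).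

Lemma kernel_fun_zmod : zmod_morphism kernel_fun.
Proof. by move=> x y; apply: val_inj; rewrite /= [LHS]raddfB. Qed.

Definition kernel_map : {additive kernel f -> kernel f'} :=
  mk_additive kernel_fun_zmod.
End KernelMap.

Section QuotientMap.
Variables (V W : zmodType) (I : zmodClosed V).

Definition quo : zmodType := Quotient.quot I.

Definition quo_pi : {additive V -> quo} := \pi_(Quotient.quot I)%qT.

Variables (f : {additive V -> W}) (fI : forall x, x \in I -> f x = 0).

Definition quo_fun (x : quo) : W := f (repr x).

Lemma quo_fun_pi (x : V) : quo_fun (quo_pi x) = f x.
Proof.
apply/eqP; rewrite -subr_eq0 -raddfB; apply/eqP/fI.
by rewrite Quotient.idealrBE reprK.
Qed.

Lemma quo_fun_zmod : zmod_morphism quo_fun.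
Proof.
move=> x y; rewrite -[x]reprK -[y]reprK.
by rewrite -(raddfB quo_pi) !quo_fun_pi raddfB.
Qed.

Definition quo_lift : {additive quo -> W} := mk_additive quo_fun_zmod.
End QuotientMap.

Section Generated.
Variables (V : zmodType) (A : V -> Prop).

Definition generated_pred : {pred V} := fun x =>
  `[< forall S : zmodClosed V, (forall y, A y -> y \in S) -> x \in S >].

Lemma generated_closed : GRing.zmod_closed generated_pred.
Proof.
split=> [|x y /asboolP xA /asboolP yA]; apply/asboolP => S AS.
  exact: rpred0.
by apply: rpredB; [exact: xA | exact: yA].
Qed.

Definition generated : zmodClosed V := mk_subgroup generated_closed.
End Generated.

Definition free_ab (X : Type) : zmodType := {freeg {classic X} / int}.

Definition free_gen (X : Type) (x : X) : free_ab X := << (x : {classic X}) >>.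

Section FreeLift.
Variables (X : Type) (V : zmodType) (f : X -> V).

Definition free_fun : free_ab X -> V :=
  fglift (f : {classic X} -> zmodule V).

Lemma free_fun_zmod : zmod_morphism free_fun.
Proof. exact: (@lift_is_additive int {classic X} (zmodule V) f). Qed.

Definition free_lift : {additive free_ab X -> V} := mk_additive free_fun_zmod.

Lemma free_lift_gen x : free_lift (free_gen x) = f x.
Proof. exact: (etrans (@liftU int (zmodule V) {classic X} f 1 x) (scale1r _)). Qed.
End FreeLift.

Lemma free_ext (X : Type) (V : zmodType) (f g : {additive free_ab X -> V}) :
  (forall x, f (free_gen x) = g (free_gen x)) -> f =1 g.
Proof.
move=> fg D; rewrite -[D]freeg_sumE !raddf_sum; apply: eq_bigr => z _.
by rewrite -[coeff z D]intz -freegU_mulz !raddfMz; congr (_ *~ _); apply: fg.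
Qed.

Record complex := Complex {
  cob :> nat -> zmodType;
  cdiff : forall n, {additive cob n.+1 -> cob n};
  cdiff_cdiff : forall n x, cdiff n (cdiff n.+1 x) = 0 }.

(* The differential out of degree n; out of degree 0 it is zero. *)
Definition cdiff_from (X : complex) (n : nat) : {additive X n -> X n.-1} :=
  match n return {additive X n -> X n.-1} with
  | 0 => \0
  | m.+1 => cdiff X m
  end.

Section Homology.
Variables (X : complex) (n : nat).

Definition boundary_pred : {pred kernel (cdiff_from X n)} :=
  fun z => `[< exists y, cdiff X n y = kernel_val z >].

Lemma boundary_closed : GRing.zmod_closed boundary_pred.
Proof.
split=> [|x y /asboolP[x' xE] /asboolP[y' yE]]; apply/asboolP.
  by exists 0; rewrite raddf0.
exists (x' - y'); rewrite raddfB xE yE.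
by rewrite -[RHS]/(kernel_incl _ (x - y)) raddfB.
Qed.

Definition boundaries := mk_subgroup boundary_closed.

Definition homology : zmodType := quo boundaries.
End Homology.

Record chain_map (X Y : complex) := ChainMap {
  chmap :> forall n, {additive X n -> Y n};
  chmap_cdiff : forall n x, chmap n (cdiff X n x) = cdiff Y n (chmap n.+1 x) }.

Section HomologyMap.
Variables (X Y : complex) (f : chain_map X Y) (n : nat).

Lemma chmap_cycle x : cdiff_from X n x = 0 -> cdiff_from Y n (f n x) = 0.
Proof. by case: n x => //= m x dx; rewrite -chmap_cdiff dx raddf0. Qed.

Lemma chmap_boundary z : z \in boundaries X n ->
  (quo_pi (boundaries Y n) \o kernel_map chmap_cycle) z = 0.
Proof.
move=> /asboolP[y yz]; apply/eqP => /=.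
rewrite -(raddf0 (quo_pi (boundaries Y n))) -Quotient.idealrBE subr0.
by apply/asboolP; exists (f n.+1 y); rewrite -chmap_cdiff yz.
Qed.

Definition homology_map : {additive homology X n -> homology Y n} :=
  quo_lift chmap_boundary.
End HomologyMap.

Section Nerve.
Variable C : smallcat.

(* A string of n composable arrows x_0 -> ... -> x_n with x_n = c, recorded *)
(* from its end: the last arrow x_(n-1) -> x_n comes first.                 *)
Fixpoint string (n : nat) (c : C) : Type :=
  match n with
  | 0 => unit
  | m.+1 => {b : C & (string m b * hom b c)%type}
  end.

Definition nerve (n : nat) : Type := {c : C & string n c}.

(* Removes the vertex x_(n-j) of x_0 -> ... -> x_(n+1), for j <= n. *)
Fixpoint string_del (n j : nat) : forall c : C, string n.+1 c -> string n c :=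
  match n return forall c : C, string n.+1 c -> string n c with
  | 0 => fun c _ => tt
  | m.+1 => fun c s =>
      let: existT b (t, f) := s in
      match j with
      | 0 => let: existT a (u, g) := t in existT _ a (u, compm f g)
      | i.+1 => existT _ b (string_del i t, f)
      end
  end.

(* Removes the vertex x_(n+1-k) of x_0 -> ... -> x_(n+1), for k <= n+1. *)
Definition nerve_del (n k : nat) (x : nerve n.+1) : nerve n :=
  let: existT c s := x in
  match k with
  | 0 => let: existT b (t, _) := s in existT _ b t
  | j.+1 => existT _ c (string_del j s)
  end.

Definition nerve_face (n : nat) (i : 'I_n.+2) (x : nerve n.+1) : nerve n :=
  nerve_del (n.+1 - i) x.

Definition nerve_diff (n : nat) :
    {additive free_ab (nerve n.+1) -> free_ab (nerve n)} :=
  free_lift (fun x => \sum_(i < n.+2) free_gen (nerve_face i x) *~ (-1) ^+ i).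

Definition nerve_aug : {additive free_ab (nerve 0) -> int} :=
  free_lift (fun=> 1).

Lemma string_del_del n j k c (s : string n.+2 c) : (j <= k <= n)%N ->
  string_del j (string_del k.+1 s) = string_del k (string_del j s).
Proof.
elim: n j k c s => [|n IHn] j k c s.
  by move=> _; case: (string_del _ _); case: (string_del _ _).
case: s => b [t f]; case: j => [|j]; last first.
  by case: k => // k jk; rewrite /= IHn.
case: t => a [t g]; case: k => [|k] //= _.
by case: t => a' [u h]; rewrite comp_assoc.
Qed.

Lemma nerve_del_del n j k (x : nerve n.+2) : (j <= k <= n.+1)%N ->
  nerve_del j (nerve_del k.+1 x) = nerve_del k (nerve_del j x).
Proof.
case: x => c s; case: j => [|j]; last first.
  by case: k => // k jk; rewrite /= string_del_del.
by case: s => b [[a [t g]] f]; case: k.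
Qed.

Lemma alternating_cancel (V : zmodType) N (a : nat -> nat -> V) :
    (forall i j, (j <= i < N)%N -> a i.+1 j = a j i) ->
  \sum_(i < N.+1) (\sum_(j < N) a i j *~ (-1) ^+ j) *~ (-1) ^+ i = 0.
Proof.
move=> aP; pose b i j := a i j *~ ((-1) ^+ (i + j)).
have -> : \sum_(i < N.+1) (\sum_(j < N) a i j *~ (-1) ^+ j) *~ (-1) ^+ i =
          \sum_(i < N.+1) \sum_(j < N | (j < i)%N) b i j +
          \sum_(i < N.+1) \sum_(j < N | (i <= j)%N) b i j.
  rewrite -big_split /=; apply: eq_bigr => i _.
  rewrite mulrz_suml (bigID (fun j : 'I_N => (j < i)%N)) /=; congr (_ + _).
    by apply: eq_bigr => j _; rewrite -mulrzA /b exprD mulrC.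
  apply: eq_big => j; first by rewrite -leqNgt.
  by rewrite -mulrzA /b exprD mulrC.
rewrite big_ord_recl big_pred0 // add0r.
rewrite [X in _ + X]big_ord_recr /= [X in _ + (_ + X)]big_pred0 ?addr0; last first.
  by move=> j; rewrite leqNgt ltn_ord.
rewrite [X in _ + X](exchange_big_dep predT) //= -big_split /=.
apply: big1 => i _; rewrite -big_split /=; apply: big1 => j ji.
rewrite /b /bump /= add1n aP ?ltn_ord ?andbT //.
by rewrite addSn exprS mulN1r mulrNz addnC addNr.
Qed.

Lemma nerve_diff_diff n x : nerve_diff n (nerve_diff n.+1 x) = 0.
Proof.
apply: (free_ext (f := nerve_diff n \o nerve_diff n.+1) (g := \0)) => {}x.
rewrite -[LHS]/(nerve_diff n (nerve_diff n.+1 (free_gen x))) free_lift_gen raddf_sum.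
pose a i j := free_gen (nerve_del (n.+1 - j) (nerve_del (n.+2 - i) x)).
rewrite -[RHS](@alternating_cancel _ n.+2 a) => [|i j /andP[ji iN]]; last first.
  have jn : (j <= n.+1)%N by exact: leq_trans ji iN.
  by rewrite /a subSS (subSn jn) nerve_del_del // leq_sub2l //= leq_subr.
by apply: eq_bigr => i _; rewrite raddfMz free_lift_gen.
Qed.

Lemma nerve_aug_diff x : nerve_aug (nerve_diff 0 x) = 0.
Proof.
apply: (free_ext (f := nerve_aug \o nerve_diff 0) (g := \0)) => {}x.
rewrite -[LHS]/(nerve_aug (nerve_diff 0 (free_gen x))) free_lift_gen.
by rewrite !big_ord_recl big_ord0 addr0 raddfD !raddfMz !free_lift_gen.
Qed.

Definition aug_nerve_ob (n : nat) : zmodType :=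
  match n with 0 => int | m.+1 => free_ab (nerve m) end.

Definition aug_nerve_diff (n : nat) :
    {additive aug_nerve_ob n.+1 -> aug_nerve_ob n} :=
  match n with 0 => nerve_aug | m.+1 => nerve_diff m end.

Lemma aug_nerve_diff_diff n x : aug_nerve_diff n (aug_nerve_diff n.+1 x) = 0.
Proof. by case: n x => [|n] x; [exact: nerve_aug_diff | exact: nerve_diff_diff]. Qed.

(* The augmented chain complex of the nerve, raised by one degree: Z stands *)
(* in degree 0 and the n-chains in degree n + 1.                            *)
Definition aug_nerve : complex := Complex aug_nerve_diff_diff.

(* Reduced homology in all degrees from -1 on. *)
Definition nontrivial_reduced_homology : Prop :=
  exists n (z : homology aug_nerve n), z <> 0.

End Nerve.

Record abfunctor (C : smallcat) := AbFunctor {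
  aob :> C -> zmodType;
  ahom : forall a b, hom a b -> {additive aob a -> aob b};
  ahom_id : forall a x, ahom (idm a) x = x;
  ahom_comp : forall a b c (g : hom b c) (f : hom a b) x,
    ahom (compm g f) x = ahom g (ahom f x) }.

Arguments ahom {C} M {a b} f : rename.

Record abnat (C : smallcat) (M N : abfunctor C) := AbNat {
  acomp :> forall c, {additive M c -> N c};
  acomp_nat : forall a b (f : hom a b) x,
    acomp b (ahom M f x) = ahom N f (acomp a x) }.

Definition const_ab (C : smallcat) (V : zmodType) : abfunctor C :=
  @AbFunctor C (fun _ => V) (fun _ _ _ => idfun)
    (fun _ _ => erefl) (fun _ _ _ _ _ _ => erefl).

Section Pullback.
Variables (D C : smallcat) (F : functor D C).

Section PullbackObject.
Variable M : abfunctor C.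

Lemma pull_id a x : ahom M (fhom F (idm a)) x = x.
Proof. by rewrite fhom_id ahom_id. Qed.

Lemma pull_comp a b c (g : hom b c) (f : hom a b) x :
  ahom M (fhom F (compm g f)) x = ahom M (fhom F g) (ahom M (fhom F f) x).
Proof. by rewrite fhom_comp ahom_comp. Qed.

Definition pull : abfunctor D :=
  @AbFunctor D (fun d => M (F d)) (fun a b f => ahom M (fhom F f))
    pull_id pull_comp.
End PullbackObject.

Definition pull_nat (M N : abfunctor C) (u : abnat M N) :
    abnat (pull M) (pull N) :=
  @AbNat D (pull M) (pull N) (fun d => u (F d))
    (fun a b f x => acomp_nat u (fhom F f) x).
End Pullback.

Section Composition.
Variables (C : smallcat) (M N P : abfunctor C) (v : abnat N P) (u : abnat M N).

Lemma comp_nat_nat a b (f : hom a b) x :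
  (v b \o u b) (ahom M f x) = ahom P f ((v a \o u a) x).
Proof. by rewrite /= !acomp_nat. Qed.

Definition comp_nat : abnat M P :=
  @AbNat C M P (fun c => v c \o u c) comp_nat_nat.
End Composition.

Definition id_nat (C : smallcat) (M : abfunctor C) : abnat M M :=
  @AbNat C M M (fun c => idfun) (fun _ _ _ _ => erefl).

(* The identity, as a map between the two readings of the restriction of M *)
(* along a composite.                                                      *)
Definition pull_compF (E D C : smallcat) (G : functor D C) (F : functor E D)
    (M : abfunctor C) : abnat (pull (compF G F) M) (pull F (pull G M)) :=
  @AbNat E (pull (compF G F) M) (pull F (pull G M)) (fun c => idfun)
    (fun _ _ _ _ => erefl).

Definition pull_eq (D C : smallcat) (F G : functor D C) (e : F = G)
    (M : abfunctor C) : abnat (pull F M) (pull G M) :=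
  match e in _ = H return abnat (pull F M) (pull H M) with
  | erefl => id_nat (pull F M)
  end.

Section Colimit.
Variables (C : smallcat) (M : abfunctor C).

(* The colimit is presented by generators [x] for c : C and x : M c, the *)
(* relations being additivity and [M f x] = [x].                         *)
Definition colim_gen (c : C) (x : M c) : free_ab {c : C & M c} :=
  free_gen (existT (fun c => M c : Type) c x).

Inductive colim_rel : free_ab {c : C & M c} -> Prop :=
  | Colim_add c (x y : M c) :
      colim_rel (colim_gen (x + y) - (colim_gen x + colim_gen y))
  | Colim_hom a b (f : hom a b) (x : M a) :
      colim_rel (colim_gen (ahom M f x) - colim_gen x).

Definition colim : zmodType := quo (generated colim_rel).

Definition colim_inj_fun (c : C) (x : M c) : colim :=
  quo_pi (generated colim_rel) (colim_gen x).

Lemma quo_pi_rel x y : colim_rel (x - y) ->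
  quo_pi (generated colim_rel) x = quo_pi (generated colim_rel) y.
Proof.
move=> xy; apply/eqP; rewrite -Quotient.idealrBE.
by apply/asboolP => S; apply.
Qed.

Lemma colim_inj_zmod c : zmod_morphism (@colim_inj_fun c).
Proof.
have D (x y : M c) : colim_inj_fun (x + y) = colim_inj_fun x + colim_inj_fun y.
  by rewrite /colim_inj_fun -raddfD; apply: quo_pi_rel; exact: Colim_add.
by move=> x y; apply: (addIr (colim_inj_fun y)); rewrite -D !subrK.
Qed.

Definition colim_inj c : {additive M c -> colim} := mk_additive (@colim_inj_zmod c).

Lemma colim_inj_hom a b (f : hom a b) x : colim_inj b (ahom M f x) = colim_inj a x.
Proof. by apply: quo_pi_rel; exact: Colim_hom. Qed.

Lemma colim_ext (V : zmodType) (f g : {additive colim -> V}) :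
  (forall c x, f (colim_inj c x) = g (colim_inj c x)) -> f =1 g.
Proof.
move=> fg x; rewrite -[x]reprK.
apply: (free_ext (f := f \o quo_pi _) (g := g \o quo_pi _)) => -[c y].
exact: fg.
Qed.

Section Universal.
Variables (V : zmodType) (k : forall c, {additive M c -> V}).
Hypothesis k_hom : forall a b (f : hom a b) x, k b (ahom M f x) = k a x.

Definition cocone_free : {additive free_ab {c : C & M c} -> V} :=
  free_lift (fun x => k (tag x) (tagged x)).

Lemma cocone_free_rel x : x \in generated colim_rel -> cocone_free x = 0.
Proof.
move=> /asboolP xR.
suff /eqP : x \in mk_subgroup (kernel_closed cocone_free) by [].
apply: xR => y; case=> [c a b | a b f z]; apply/eqP.
  by rewrite raddfB raddfD !free_lift_gen /= raddfD subrr.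
by rewrite raddfB !free_lift_gen /= k_hom subrr.
Qed.

Definition colim_desc : {additive colim -> V} := quo_lift cocone_free_rel.

Lemma colim_desc_inj c x : colim_desc (colim_inj c x) = k c x.
Proof. exact: etrans (quo_fun_pi cocone_free_rel (colim_gen x)) (free_lift_gen _ _). Qed.
End Universal.

Theorem colim_universal (V : zmodType) (k : forall c, {additive M c -> V}) :
    (forall a b (f : hom a b) x, k b (ahom M f x) = k a x) ->
  exists2 u : {additive colim -> V},
    forall c x, u (colim_inj c x) = k c x &
    forall v : {additive colim -> V},
      (forall c x, v (colim_inj c x) = k c x) -> v =1 u.
Proof.
move=> kP; exists (colim_desc kP) => [|v vk]; first exact: colim_desc_inj.
by apply: colim_ext => c x; rewrite vk colim_desc_inj.
Qed.
End Colimit.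

Section ColimitMap.
(* The map colim N -> colim M induced by F and a transformation N -> F^* M. *)
Variables (D C : smallcat) (F : functor D C).
Variables (N : abfunctor D) (M : abfunctor C) (u : abnat N (pull F M)).

Lemma colim_map_cocone a b (f : hom a b) x :
  (colim_inj M (F b) \o u b) (ahom N f x) = (colim_inj M (F a) \o u a) x.
Proof. by rewrite /= acomp_nat; exact: (colim_inj_hom (fhom F f) (u a x)). Qed.

Definition colim_map : {additive colim N -> colim M} :=
  colim_desc colim_map_cocone.

Lemma colim_map_inj d x : colim_map (colim_inj N d x) = colim_inj M (F d) (u d x).
Proof. exact: colim_desc_inj. Qed.
End ColimitMap.

Definition idF (C : smallcat) : functor C C :=
  @Functor C C id (fun _ _ f => f) (fun _ => erefl) (fun _ _ _ _ _ => erefl).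

Definition to_pull_idF (C : smallcat) (M N : abfunctor C) (u : abnat M N) :
    abnat M (pull (idF C) N) :=
  @AbNat C M (pull (idF C) N) u (@acomp_nat C M N u).

Definition colim_nat (C : smallcat) (M N : abfunctor C) (u : abnat M N) :
  {additive colim M -> colim N} := colim_map (to_pull_idF u).

(* Epimorphisms and exactness in [C, Ab] are objectwise. *)
Definition epi (C : smallcat) (M N : abfunctor C) (u : abnat M N) : Prop :=
  forall c y, exists x, u c x = y.

Definition projective (C : smallcat) (P : abfunctor C) : Prop :=
  forall (M N : abfunctor C) (u : abnat M N) (v : abnat P N), epi u ->
  exists w : abnat P M, forall c x, u c (w c x) = v c x.

Definition exact_at (A B C : Type) (zero : C) (f : A -> B) (g : B -> C) : Prop :=
  forall y, g y = zero <-> exists x, f x = y.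

Record resolution (C : smallcat) (M : abfunctor C) := Resolution {
  rob :> nat -> abfunctor C;
  rdiff : forall n, abnat (rob n.+1) (rob n);
  raug : abnat (rob 0%N) M;
  rob_projective : forall n, projective (rob n);
  raug_epi : epi raug;
  raug_exact : forall c, exact_at 0 (rdiff 0 c) (raug c);
  rdiff_exact : forall n c, exact_at 0 (rdiff n.+1 c) (rdiff n c) }.

(* A chain map from a resolution of N to F^* of a resolution of M lying over *)
(* a transformation N -> F^* M.                                              *)
Record comparison (D C : smallcat) (F : functor D C)
    (N : abfunctor D) (M : abfunctor C) (u : abnat N (pull F M))
    (Q : resolution N) (P : resolution M) := Comparison {
  cmp :> forall n, abnat (Q n) (pull F (P n));
  cmp_aug : forall d x, raug P (F d) (cmp 0%N d x) = u d (raug Q d x);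
  cmp_diff : forall n d x,
    rdiff P n (F d) (cmp n.+1 d x) = cmp n d (rdiff Q n d x) }.

Section KernelFunctor.
Variables (C : smallcat) (M N : abfunctor C) (u : abnat M N).

Lemma ker_functor_hom a b (f : hom a b) x : u a x = 0 -> u b (ahom M f x) = 0.
Proof. by move=> ux; rewrite acomp_nat ux raddf0. Qed.

Lemma ker_functor_id a x : kernel_map (ker_functor_hom (idm a)) x = x.
Proof. by apply: val_inj; rewrite /= ahom_id. Qed.

Lemma ker_functor_comp a b c (g : hom b c) (f : hom a b) x :
  kernel_map (ker_functor_hom (compm g f)) x =
  kernel_map (ker_functor_hom g) (kernel_map (ker_functor_hom f) x).
Proof. by apply: val_inj; rewrite /= ahom_comp. Qed.

Definition ker_functor : abfunctor C :=
  @AbFunctor C (fun c => kernel (u c)) (fun a b f => kernel_map (ker_functor_hom f))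
    ker_functor_id ker_functor_comp.

Definition ker_incl : abnat ker_functor M :=
  @AbNat C ker_functor M (fun c => kernel_incl (u c)) (fun _ _ _ _ => erefl).

Variables (L : abfunctor C) (v : abnat L M) (uv : forall c x, u c (v c x) = 0).

Definition ker_lift_fun c (x : L c) : kernel (u c) := mk_kernel (uv x).

Lemma ker_lift_zmod c : zmod_morphism (@ker_lift_fun c).
Proof. by move=> x y; apply: val_inj; rewrite /= [LHS]raddfB. Qed.

Lemma ker_lift_nat a b (f : hom a b) x :
  mk_additive (@ker_lift_zmod b) (ahom L f x) =
  ahom ker_functor f (mk_additive (@ker_lift_zmod a) x).
Proof. by apply: val_inj; rewrite /= acomp_nat. Qed.

Definition ker_lift : abnat L ker_functor :=
  @AbNat C L ker_functor (fun c => mk_additive (@ker_lift_zmod c)) ker_lift_nat.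
End KernelFunctor.

Lemma projective_lift (C : smallcat) (P L M N : abfunctor C)
    (v : abnat L M) (u : abnat M N) (w : abnat P M) :
    projective P -> (forall c, exact_at 0 (v c) (u c)) ->
    (forall c x, u c (w c x) = 0) ->
  exists t : abnat P L, forall c x, v c (t c x) = w c x.
Proof.
move=> prP vu uw.
have uv c x : u c (v c x) = 0 by apply/vu; exists x.
have vE : epi (ker_lift uv).
  move=> c y; have /vu[x xy] := kernel_eq0 y.
  by exists x; apply: val_inj.
have [t tE] := prP _ _ _ (ker_lift uw) vE; exists t => c x.
exact: (congr1 (@kernel_val _ _ _) (tE c x)).
Qed.

Section FreeFunctor.
(* The direct sum over i : I of the functors Z[hom (s i) -]. *)
Variables (C : smallcat) (I : Type) (s : I -> C).

Definition free_ob (c : C) : zmodType := free_ab {i : I & hom (s i) c}.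

Definition free_hom a b (f : hom a b) : {additive free_ob a -> free_ob b} :=
  free_lift (fun x : {i : I & hom (s i) a} =>
    free_gen (existT (fun i => hom (s i) b) (tag x) (compm f (tagged x)))).

Lemma free_hom_id a x : free_hom (idm a) x = x.
Proof.
apply: (free_ext (g := idfun)) => -[i h].
by rewrite free_lift_gen /= comp_idl.
Qed.

Lemma free_hom_comp a b c (g : hom b c) (f : hom a b) x :
  free_hom (compm g f) x = free_hom g (free_hom f x).
Proof.
apply: (free_ext (g := free_hom g \o free_hom f)) => -[i h].
by rewrite -[RHS]/(free_hom g (free_hom f _)) !free_lift_gen /= comp_assoc.
Qed.

Definition free_functor : abfunctor C := AbFunctor free_hom_id free_hom_comp.

Section FreeFunctorLift.
Variables (M : abfunctor C) (m : forall i, M (s i)).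

Definition free_functor_comp c : {additive free_ob c -> M c} :=
  free_lift (fun x : {i : I & hom (s i) c} => ahom M (tagged x) (m (tag x))).

Lemma free_functor_nat a b (f : hom a b) x :
  free_functor_comp b (free_hom f x) = ahom M f (free_functor_comp a x).
Proof.
apply: (free_ext (f := free_functor_comp b \o free_hom f)
                 (g := ahom M f \o free_functor_comp a)) => -[i h].
rewrite -[LHS]/(free_functor_comp b (free_hom f _)).
by rewrite -[RHS]/(ahom M f (free_functor_comp a _)) !free_lift_gen /= ahom_comp.
Qed.

Definition free_functor_lift : abnat free_functor M :=
  @AbNat C free_functor M free_functor_comp free_functor_nat.

Lemma free_functor_lift_gen c i (h : hom (s i) c) :
  free_functor_lift c (free_gen (existT (fun i => hom (s i) c) i h)) =
  ahom M h (m i).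
Proof. exact: free_lift_gen. Qed.
End FreeFunctorLift.

Lemma free_functor_projective : projective free_functor.
Proof.
move=> M N u v uE.
pose y i := v (s i) (free_gen (existT (fun j => hom (s j) (s i)) i (idm (s i)))).
pose m i := projT1 (cid (uE (s i) (y i))).
have mE i : u (s i) (m i) = y i by exact: projT2 (cid (uE (s i) (y i))).
exists (free_functor_lift m) => c x.
apply: (free_ext (f := u c \o free_functor_lift m c) (g := v c)) => -[i h].
transitivity (u c (ahom M h (m i))).
  by congr (u c _); exact: free_functor_lift_gen.
rewrite acomp_nat mE -acomp_nat; congr (v c _).
by apply: (etrans (free_lift_gen _ _)); rewrite /= comp_idr.
Qed.
End FreeFunctor.

Section FreeResolution.
Variable C : smallcat.

Definition free_cover (M : abfunctor C) : abfunctor C :=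
  free_functor (fun i : {c : C & M c} => tag i).

Definition cover_map (M : abfunctor C) : abnat (free_cover M) M :=
  free_functor_lift (s := fun i : {c : C & M c} => tag i) (fun i => tagged i).

Lemma cover_map_epi M : epi (cover_map M).
Proof.
move=> c y; pose i := existT (fun c => M c : Type) c y.
exists (free_gen (existT (fun j : {c : C & M c} => hom (tag j) c) i (idm c))).
by rewrite free_functor_lift_gen ahom_id.
Qed.

Variable M : abfunctor C.

Fixpoint syzygy (n : nat) : abfunctor C :=
  match n with 0 => M | m.+1 => ker_functor (cover_map (syzygy m)) end.

Definition free_res_diff n :
    abnat (free_cover (syzygy n.+1)) (free_cover (syzygy n)) :=
  comp_nat (ker_incl (cover_map (syzygy n))) (cover_map (syzygy n.+1)).

Lemma free_res_diff_eq0 n c x :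
  free_res_diff n c x = 0 <-> cover_map (syzygy n.+1) c x = 0.
Proof.
split=> [dx|cx]; first exact: val_inj.
exact: (congr1 (@kernel_val _ _ _) cx).
Qed.

Lemma free_res_diff_im n c y :
  (exists x, free_res_diff n c x = y) <-> cover_map (syzygy n) c y = 0.
Proof.
split=> [[x <-]|cy]; first exact: kernel_eq0.
have [x xE] := cover_map_epi (mk_kernel cy : syzygy n.+1 c).
by exists x; exact: (congr1 (@kernel_val _ _ _) xE).
Qed.

Lemma free_res_exact0 c :
  exact_at 0 (free_res_diff 0 c) (cover_map (syzygy 0) c).
Proof. by move=> y; apply: iff_sym; exact: free_res_diff_im. Qed.

Lemma free_res_exact n c :
  exact_at 0 (free_res_diff n.+1 c) (free_res_diff n c).
Proof.
move=> y; apply: iff_sym.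
exact: iff_trans (free_res_diff_im y) (iff_sym (free_res_diff_eq0 y)).
Qed.

Definition free_resolution : resolution M :=
  @Resolution C M (fun n => free_cover (syzygy n)) free_res_diff (cover_map M)
    (fun n => @free_functor_projective C _ _) (@cover_map_epi M)
    free_res_exact0 free_res_exact.
End FreeResolution.

Section ComparisonExists.
Variables (D C : smallcat) (F : functor D C).
Variables (N : abfunctor D) (M : abfunctor C) (u : abnat N (pull F M)).
Variables (Q : resolution N) (P : resolution M).

Definition cmp_good (n : nat) (l : abnat (Q n) (pull F (P n))) : Prop :=
  forall d x, match n return abnat (Q n) (pull F (P n)) -> Q n.+1 d -> Prop with
    | 0 => fun l x => raug P (F d) (l d (rdiff Q 0 d x)) = 0
    | m.+1 => fun l x => rdiff P m (F d) (l d (rdiff Q m.+1 d x)) = 0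
    end l x.

Lemma cmp_start : exists l : abnat (Q 0%N) (pull F (P 0%N)),
  (forall d x, raug P (F d) (l d x) = u d (raug Q d x)) /\ cmp_good l.
Proof.
have PE : epi (pull_nat F (raug P)) by move=> d y; exact: raug_epi.
have [l lE] := @rob_projective _ _ Q 0%N _ _ _ (comp_nat u (raug Q)) PE.
exists l; split=> [//|d x /=]; rewrite [LHS]lE /=.
suff -> : raug Q d (rdiff Q 0 d x) = 0 by rewrite raddf0.
by apply/raug_exact; exists x.
Qed.

Lemma cmp_step n (l : abnat (Q n) (pull F (P n))) : cmp_good l ->
  exists l' : abnat (Q n.+1) (pull F (P n.+1)),
    (forall d x, rdiff P n (F d) (l' d x) = l d (rdiff Q n d x)) /\ cmp_good l'.
Proof.
move=> lG.
have [l' l'E] : exists l' : abnat (Q n.+1) (pull F (P n.+1)),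
    forall d x, rdiff P n (F d) (l' d x) = l d (rdiff Q n d x).
  case: n l lG => [|n] l lG.
  - apply: (projective_lift (v := pull_nat F (rdiff P 0))
      (u := pull_nat F (raug P)) (w := comp_nat l (rdiff Q 0))).
    + exact: rob_projective.
    + by move=> d; exact: raug_exact.
    + exact: lG.
  - apply: (projective_lift (v := pull_nat F (rdiff P n.+1))
      (u := pull_nat F (rdiff P n)) (w := comp_nat l (rdiff Q n.+1))).
    + exact: rob_projective.
    + by move=> d; exact: rdiff_exact.
    + exact: lG.
exists l'; split=> // d x /=; rewrite l'E.
suff -> : rdiff Q n d (rdiff Q n.+1 d x) = 0 by rewrite raddf0.
by apply/rdiff_exact; exists x.
Qed.

Lemma comparison_exists : inhabited (comparison u Q P).
Proof.
have [l0 [l0E l0G]] := cmp_start.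
pose T n := {l : abnat (Q n) (pull F (P n)) | cmp_good l}.
pose next n (l : T n) : T n.+1 :=
  let h := cid (cmp_step (projT2 l)) in exist _ (projT1 h) (projT2 h).2.
pose fix L n : T n := match n with 0 => exist _ l0 l0G | m.+1 => next m (L m) end.
split; exists (fun n => projT1 (L n)) => [d x|n d x]; first exact: l0E.
exact: (projT2 (cid (cmp_step (projT2 (L n))))).1.
Qed.
End ComparisonExists.

Section ColimitComplex.
Variables (C : smallcat) (M : abfunctor C) (P : resolution M).

Lemma colim_diff_diff n x :
  colim_nat (rdiff P n) (colim_nat (rdiff P n.+1) x) = 0.
Proof.
apply: (colim_ext (f := colim_nat (rdiff P n) \o colim_nat (rdiff P n.+1))
                  (g := \0)) => c y.
transitivity (colim_inj (P n) c (rdiff P n c (rdiff P n.+1 c y))).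
  apply: (etrans (congr1 (colim_nat (rdiff P n)) (colim_map_inj _ y))).
  exact: colim_map_inj.
suff -> : rdiff P n c (rdiff P n.+1 c y) = 0 by rewrite raddf0.
by apply/rdiff_exact; exists y.
Qed.

Definition colim_complex : complex :=
  @Complex (fun n => colim (P n)) (fun n => colim_nat (rdiff P n))
    colim_diff_diff.
End ColimitComplex.

Section ColimitComplexMap.
Variables (D C : smallcat) (F : functor D C).
Variables (N : abfunctor D) (M : abfunctor C) (u : abnat N (pull F M)).
Variables (Q : resolution N) (P : resolution M) (l : comparison u Q P).

Lemma colim_cmp_diff n x :
  colim_map (l n) (cdiff (colim_complex Q) n x) =
  cdiff (colim_complex P) n (colim_map (l n.+1) x).
Proof.
apply: (colim_ext (f := colim_map (l n) \o colim_nat (rdiff Q n))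
                  (g := colim_nat (rdiff P n) \o colim_map (l n.+1))) => d y.
transitivity (colim_inj (P n) (F d) (l n d (rdiff Q n d y))).
  apply: (etrans (congr1 (colim_map (l n)) (colim_map_inj _ y))).
  exact: colim_map_inj.
rewrite -cmp_diff; apply: esym.
apply: (etrans (congr1 (colim_nat (rdiff P n)) (colim_map_inj _ y))).
exact: colim_map_inj.
Qed.

Definition colim_complex_map : chain_map (colim_complex Q) (colim_complex P) :=
  @ChainMap (colim_complex Q) (colim_complex P) (fun n => colim_map (l n))
    colim_cmp_diff.
End ColimitComplexMap.

(* The left derived functors of the colimit, computed on one projective *)
(* resolution of each functor; they vanish in negative degrees.         *)
Definition colimn (C : smallcat) (n : nat) (M : abfunctor C) : zmodType :=
  homology (colim_complex (free_resolution M)) n.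

(* The map colim_n N -> colim_n M induced by F and a transformation          *)
(* N -> F^* M: any comparison map over the transformation is taken, as they  *)
(* are all chain homotopic. It is colim_n (F^* M) -> colim_n M for the       *)
(* identity of F^* M.                                                        *)
Definition colimn_map (D C : smallcat) (F : functor D C) (n : nat)
    (N : abfunctor D) (M : abfunctor C) (u : abnat N (pull F M)) :
    {additive colimn n N -> colimn n M} :=
  homology_map (colim_complex_map (inhabited_witness
    (comparison_exists u (free_resolution N) (free_resolution M)))) n.

Section MayerVietoris.
Variables (C0 C1 C2 C : smallcat) (F1 : functor C0 C1) (F2 : functor C0 C2).
Variables (J1 : functor C1 C) (J2 : functor C2 C).
Variables (comm : compF J1 F1 = compF J2 F2) (M : abfunctor C).

Let M0 : abfunctor C0 := pull (compF J1 F1) M.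
Let M1 : abfunctor C1 := pull J1 M.
Let M2 : abfunctor C2 := pull J2 M.

Definition mv_left (n : nat) (x : colimn n M0) :
    (colimn n M1 * colimn n M2)%type :=
  (colimn_map n (pull_compF J1 F1 M) x,
   - colimn_map n (comp_nat (pull_compF J2 F2 M) (pull_eq comm M)) x).

Definition mv_right (n : nat) (y : (colimn n M1 * colimn n M2)%type) :
    colimn n M :=
  colimn_map n (id_nat M1) y.1 + colimn_map n (id_nat M2) y.2.

(* In degree 0 the sequence ends with colim_0 M -> 0, whence surjectivity. *)
Definition has_mayer_vietoris : Prop :=
  exists boundary : forall n, {additive colimn n.+1 M -> colimn n M0},
    [/\ forall n, exact_at 0 (boundary n) (@mv_left n),
        forall n, exact_at 0 (@mv_left n) (@mv_right n),
        forall n, exact_at 0 (@mv_right n.+1) (boundary n) &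
        forall z : colimn 0 M, exists y, mv_right y = z].
End MayerVietoris.

(* Main.v *)
From Stdlib Require Import Relations.Relation_Operators.
From mathcomp Require Import all_boot all_order all_algebra.
From mathcomp Require Import boolp.
From mathcomp.multinomials Require Import freeg.
Require Import Defs.

(* The pushout C is C_0 with both a disjoint initial and a disjoint terminal   *)
(* object: there is only one arrow 0 -> 1, because C_0 is connected. On C_1    *)
(* and on C, which have an initial object, the constant functor Z is           *)
(* representable, hence projective; on C_2 the colimit is evaluation at the    *)
(* terminal object, hence exact. So all derived colimits of Z in positive      *)
(* degree vanish on C_1, C_2 and C, and exactness of the Mayer-Vietoris        *)
(* sequence would force them to vanish on C_0 too. But the bar resolution of Z *)
(* identifies them with the homology of the nerve of C_0.                      *)
(* For the group of integers, the cocycle sending the arrow n to n detects the *)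
(* class of the arrow 1 in degree 1.                                           *)

Set Implicit Arguments.
Unset Strict Implicit.
Unset Printing Implicit Defensive.

Import GRing.Theory.
Local Open Scope ring_scope.

(** * Arrows and the pushout *)

(** The argument is about positive-degree vanishing of derived colimits of the constant functor Z
    ([acyclic]). If the other three corners of the square are acyclic, a Mayer-Vietoris sequence
    squeezes the derived colimits over [C0] between zeros ([mayer_vietoris_acyclic]). Acyclicity of
    the other corners comes from projectivity ([initial_const_projective], [projective_exact_colim])
    or from a terminal object ([terminal_exact_colim]). The pushout is known only by its universal
    property, so it is exhibited as a retract of the explicit model [add_terminal (add_initial C0)]
    ([pushout_const_acyclic]).

    [exact_colim_indep] then trades the free resolution inside [colimn] for the bar resolution. The
    chains of the nerve are a retract of its colimit complex, so acyclicity over a connected [C0]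
    would make all reduced homology vanish ([reduced_homology_trivial]), a contradiction. *)

Lemma existT_inj (A : Type) (P : A -> Type) (a : A) (x y : P a) :
  existT P a x = existT P a y -> x = y.
Proof.
by move=> e; have := projT2_eq e; rewrite (Prop_irrelevance (projT1_eq e) erefl).
Qed.

(* Equality in the type of all arrows compares arrows of [C] whose end points *)
(* are only propositionally equal.                                            *)
Definition arrow (C : smallcat) (a b : C) (f : hom a b) :
    {p : C * C & hom p.1 p.2} :=
  existT (fun p : C * C => hom p.1 p.2) (a, b) f.

Lemma arrow_inj (C : smallcat) (a b : C) : injective (@arrow C a b).
Proof. by move=> f g e; exact: (existT_inj e). Qed.

Lemma arrow_comp (C : smallcat) (a b c a' b' c' : C) (g : hom b c) (f : hom a b)
    (g' : hom b' c') (f' : hom a' b') :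
  arrow g = arrow g' -> arrow f = arrow f' ->
  arrow (compm g f) = arrow (compm g' f').
Proof.
move=> eg ef; case: (congr1 (@projT1 _ _) eg) => eb ec.
case: (congr1 (@projT1 _ _) ef) => ea _.
by subst; rewrite (arrow_inj eg) (arrow_inj ef).
Qed.

Lemma functor_arrow (C D : smallcat) (F G : functor C D) (a b : C) (f : hom a b) :
  F = G -> arrow (fhom F f) = arrow (fhom G f).
Proof. by move=> ->. Qed.

Lemma functor_ext (C D : smallcat) (F G : functor C D) :
  (forall a b (f : hom a b), arrow (fhom F f) = arrow (fhom G f)) -> F = G.
Proof.
case: F G => [o h i c] [o' h' i' c'] /= E.
(* The end points of the images of identities recover the object maps. *)
have eo : o = o' by apply/funext => a; case: (congr1 (@projT1 _ _) (E a a (idm a))).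
subst o'; have eh : h = h'.
  do 3 apply/functional_extensionality_dep => ?.
  exact/arrow_inj/E.
by subst h'; congr Functor; exact: Prop_irrelevance.
Qed.

Section TerminalDesc.
Variables (C D : smallcat) (G : functor C D) (d : D) (t : forall a, hom (G a) d).
Hypothesis t_nat : forall a b (f : hom a b), compm (t b) (fhom G f) = t a.

Definition terminal_desc_ob (a : add_terminal C) : D := oapp G d a.

Definition terminal_desc_hom (a b : add_terminal C) :
    hom a b -> hom (terminal_desc_ob a) (terminal_desc_ob b) :=
  match a, b return
    terminal_hom a b -> hom (terminal_desc_ob a) (terminal_desc_ob b) with
  | Some _, Some _ => fun f => fhom G f
  | Some x, None => fun=> t x
  | None, None => fun=> idm d
  | None, Some _ => fun f => match f with end
  end.

Lemma terminal_desc_id a :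
  terminal_desc_hom (idm a) = idm (terminal_desc_ob a).
Proof. by case: a => [a|] //=; exact: fhom_id. Qed.

Lemma terminal_desc_comp a b c (g : hom b c) (f : hom a b) :
  terminal_desc_hom (compm g f) =
  compm (terminal_desc_hom g) (terminal_desc_hom f).
Proof.
case: a b c g f => [a|] [b|] [c|] //=; try by [case | move=> ? []].
- by move=> g f; exact: fhom_comp.
- by move=> *; rewrite comp_idl.
- by move=> *; rewrite comp_idl.
Qed.

(** A functor out of [add_terminal C] amounts to a functor on [C] with a cocone [t] under it. *)
Definition terminal_desc : functor (add_terminal C) D :=
  Functor terminal_desc_id terminal_desc_comp.
End TerminalDesc.

(** * The explicit pushout, with both an initial and a terminal object adjoined *)

Section InitialTerminalPushout.
Variable C : smallcat.

Let incl : functor C (add_terminal (add_initial C)) :=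
  compF (terminal_incl (add_initial C)) (initial_incl C).

Definition add_initial_terminal_incl :
    functor (add_terminal C) (add_terminal (add_initial C)) :=
  @terminal_desc C _ incl None (fun=> tt) (fun _ _ _ => erefl).

Lemma add_initial_terminal_incl_injective :
  injective_functor add_initial_terminal_incl.
Proof.
split; first by case=> [a|] [b|] //= [->].
by case=> [a|] [b|] //= [] [].
Qed.

Hypothesis C_connected : connected C.

Section Desc.
Variables (D : smallcat) (G1 : functor (add_initial C) D).
Variables (G2 : functor (add_terminal C) D).
Hypothesis G12 : compF G1 (initial_incl C) = compF G2 (terminal_incl C).

Let to_top (x : C) : hom (Some x : add_terminal C) None := tt.
Let from_bot (x : C) : hom (None : add_initial C) (Some x) := tt.

(** [G1] and [G2] agree on [C] only propositionally, so the arrow to the top must be transported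
    before it can be composed with arrows in the image of [G1]. *)
Lemma to_top_transport x :
  exists t : hom (G1 (Some x)) (G2 None), arrow t = arrow (fhom G2 (to_top x)).
Proof.
have e : G1 (Some x) = G2 (Some x) := congr1 (fun H : functor C D => H x) G12.
move: (fhom G2 (to_top x)) => t.
move: t; rewrite -[fob G2 (Some x)]e => t.
by exists t.
Qed.

Let leg x := projT1 (cid (to_top_transport x)).
Let legE x : arrow (leg x) = arrow (fhom G2 (to_top x)).
Proof. exact: projT2 (cid (to_top_transport x)). Qed.

Let leg_nat x y (f : hom x y) :
  compm (leg y) (fhom G1 (f : hom (Some x : add_initial C) (Some y))) = leg x.
Proof.
apply: arrow_inj; rewrite legE.
rewrite -[to_top x]/(compm (to_top y) (fhom (terminal_incl C) f)) fhom_comp.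
by apply: arrow_comp; [exact: legE | exact: (functor_arrow f G12)].
Qed.

Let through x : hom (G1 None) (G2 None) := compm (leg x) (fhom G1 (from_bot x)).

(** Connectedness enters here: the composite 0 -> x -> 1 does not change along an arrow from x to y,
    hence not along a zigzag. *)
Let through_eq x y : through x = through y.
Proof.
elim: (C_connected.2 x y) => [a b [f]|a|a b _ ->|a b c _ -> _ ->] //.
rewrite /through -(leg_nat f) -comp_assoc -fhom_comp.
by congr (compm _ (fhom G1 _)).
Qed.

Lemma pushout_desc_exists :
  exists H : functor (add_terminal (add_initial C)) D,
    compF H (terminal_incl (add_initial C)) = G1 /\
    compF H add_initial_terminal_incl = G2.
Proof.
have [x0] := C_connected.1.
(* The two functors are glued as a cocone under [G1]; its leg at the initial object may go through
   any object. *)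
pose t (a : add_initial C) : hom (G1 a) (G2 None) :=
  match a return hom (G1 a) (G2 None) with
  | Some x => leg x | None => through x0 end.
have t_nat a b (f : hom a b) : compm (t b) (fhom G1 f) = t a.
  case: a b f => [a|] [b|] //= f.
    by case: f; rewrite (through_eq x0 b).
  by case: f; rewrite -[tt]/(idm (None : add_initial C)) fhom_id comp_idr.
exists (terminal_desc t_nat); split; apply: functor_ext => // -[a|] [b|] //= f.
- exact: (functor_arrow f G12).
- by case: f; exact: legE.
- by case: f; rewrite -[tt]/(idm (None : add_terminal C)) fhom_id.
Qed.
End Desc.

Lemma add_initial_terminal_ext (D : smallcat)
    (H K : functor (add_terminal (add_initial C)) D) :
  compF H (terminal_incl (add_initial C)) =
    compF K (terminal_incl (add_initial C)) ->
  compF H add_initial_terminal_incl = compF K add_initial_terminal_incl ->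
  H = K.
Proof.
move=> e1 e2; apply: functor_ext => a b f.
have [x0] := C_connected.1.
have e1' x y g := @functor_arrow _ _ _ _ x y g e1.
have e2' x y g := @functor_arrow _ _ _ _ x y g e2.
case: a b f => [a|] [b|] //= f; first exact: e1'.
  case: a f => [a|] [].
    exact: (e2' (Some a) None tt).
  (* The arrow 0 -> 1 lies in the image of neither inclusion, but it factors through [x0] into two
     arrows that do. *)
  pose g : hom (Some (Some x0) : add_terminal (add_initial C)) None := tt.
  pose h : hom (Some None : add_terminal (add_initial C)) (Some (Some x0)) := tt.
  rewrite -[tt]/(compm g h) !fhom_comp.
  apply: arrow_comp; first exact: (e2' (Some x0) None tt).
  exact: (e1' None (Some x0) tt).
by case: f; exact: (e2' None None tt).
Qed.

Lemma add_initial_terminal_pushout :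
  is_pushout (initial_incl C) (terminal_incl C)
    (terminal_incl (add_initial C)) add_initial_terminal_incl.
Proof.
split=> [|D G1 G2 G12]; first exact: functor_ext.
have [H HE] := pushout_desc_exists G12; exists H; split=> // K [K1 K2].
by apply: add_initial_terminal_ext; rewrite ?HE.1 ?HE.2.
Qed.
End InitialTerminalPushout.

(** * Null homotopies and independence of the resolution *)

Lemma homology_eq0 (X : complex) (n : nat) :
  (forall z : homology X n, z = 0) <->
  (forall x, cdiff_from X n x = 0 -> exists y, cdiff X n y = x).
Proof.
split=> [H x dx | H z].
  have /eqP := H (quo_pi (boundaries X n) (mk_kernel dx)).
  by rewrite -(raddf0 (quo_pi _)) -Quotient.idealrBE subr0 => /asboolP.
rewrite -[z]reprK; apply/eqP.
rewrite -(raddf0 (quo_pi (boundaries X n))) -Quotient.idealrBE subr0.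
by apply/asboolP; apply: H; exact: kernel_eq0.
Qed.

Definition acyclic (C : smallcat) (M : abfunctor C) : Prop :=
  forall n (z : colimn n.+1 M), z = 0.

Definition exact_colim (C : smallcat) (M : abfunctor C) (P : resolution M) : Prop :=
  forall n (x : colim (P n.+1)), colim_nat (rdiff P n) x = 0 ->
  exists y, colim_nat (rdiff P n.+1) y = x.

Lemma acyclic_exact_colim (C : smallcat) (M : abfunctor C) :
  acyclic M <-> exact_colim (free_resolution M).
Proof.
by split=> H n; [exact: (homology_eq0 _ _).1 (H n) |
  exact: (homology_eq0 (colim_complex (free_resolution M)) n.+1).2 (H n)].
Qed.

Lemma colim_nat_inj (C : smallcat) (M N : abfunctor C) (u : abnat M N) c x :
  colim_nat u (colim_inj M c x) = colim_inj N c (u c x).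
Proof. exact: colim_map_inj. Qed.

Section SubNat.
Variables (C : smallcat) (M N : abfunctor C) (u v : abnat M N).

Lemma sub_nat_zmod c : zmod_morphism (fun x => u c x - v c x).
Proof. by move=> x y /=; rewrite (raddfB (u c)) (raddfB (v c)) !opprD addrACA. Qed.

Lemma sub_nat_nat a b (f : hom a b) x :
  mk_additive (@sub_nat_zmod b) (ahom M f x) =
  ahom N f (mk_additive (@sub_nat_zmod a) x).
Proof. by rewrite /= raddfB !acomp_nat. Qed.

Definition sub_nat : abnat M N :=
  @AbNat C M N (fun c => mk_additive (@sub_nat_zmod c)) sub_nat_nat.
End SubNat.

Lemma colim_nat_ext (C : smallcat) (M N : abfunctor C) (u v : abnat M N) :
  (forall c x, u c x = v c x) -> colim_nat u =1 colim_nat v.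
Proof. by move=> uv; apply: colim_ext => c x; rewrite !colim_nat_inj uv. Qed.

Lemma colim_nat_id (C : smallcat) (M : abfunctor C) x :
  colim_nat (id_nat M) x = x.
Proof.
apply: (colim_ext (f := colim_nat (id_nat M)) (g := idfun)) => c y.
exact: colim_nat_inj.
Qed.

Lemma colim_nat_comp (C : smallcat) (M N P : abfunctor C) (v : abnat N P)
    (u : abnat M N) x :
  colim_nat (comp_nat v u) x = colim_nat v (colim_nat u x).
Proof.
apply: (colim_ext (f := colim_nat (comp_nat v u))
  (g := colim_nat v \o colim_nat u)) => c y.
by rewrite -[RHS]/(colim_nat v (colim_nat u _)) !colim_nat_inj.
Qed.

Lemma colim_nat_sub (C : smallcat) (M N : abfunctor C) (u v : abnat M N) x :
  colim_nat (sub_nat u v) x = colim_nat u x - colim_nat v x.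
Proof.
apply: (colim_ext (f := colim_nat (sub_nat u v))
  (g := colim_nat u \- colim_nat v)) => c y.
by rewrite -[RHS]/(colim_nat u _ - colim_nat v _) !colim_nat_inj -raddfB.
Qed.

Section NullHomotopy.
Variables (C : smallcat) (M : abfunctor C) (P : resolution M).
Variable k : forall n, abnat (P n) (P n).
Hypothesis k_aug : forall c x, raug P c (k 0%N c x) = 0.
Hypothesis k_diff : forall n c x,
  rdiff P n c (k n.+1 c x) = k n c (rdiff P n c x).

Lemma rdiff_rdiff n c x : rdiff P n c (rdiff P n.+1 c x) = 0.
Proof. by apply/rdiff_exact; exists x. Qed.

(** Asking for the homotopy identity only after precomposing with the differential removes the lower
    homotopy term, as d d = 0. The induction thus carries one map instead of two consecutive
    ones. *)
Lemma homotopy_on_boundaries n : exists h : abnat (P n) (P n.+1),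
  forall c x, rdiff P n c (h c (rdiff P n c x)) = k n c (rdiff P n c x).
Proof.
elim: n => [|n [h hE]].
  have [h hE] := projective_lift (@rob_projective _ _ P 0%N)
    (@raug_exact _ _ P) k_aug.
  by exists h => c x; rewrite hE.
have h0 c x : rdiff P n c (sub_nat (k n.+1) (comp_nat h (rdiff P n)) c x) = 0.
  by rewrite /= raddfB k_diff /= hE subrr.
have [h' h'E] := projective_lift (@rob_projective _ _ P n.+1)
  (@rdiff_exact _ _ P n) h0.
by exists h' => c x; rewrite h'E /= rdiff_rdiff raddf0 subr0.
Qed.

Lemma null_homotopy n :
  exists (h : abnat (P n) (P n.+1)) (h' : abnat (P n.+1) (P n.+2)),
  forall c x, rdiff P n.+1 c (h' c x) = k n.+1 c x - h c (rdiff P n c x).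
Proof.
have [h hE] := homotopy_on_boundaries n.
have h0 c x : rdiff P n c (sub_nat (k n.+1) (comp_nat h (rdiff P n)) c x) = 0.
  by rewrite /= raddfB k_diff /= hE subrr.
have [h' h'E] := projective_lift (@rob_projective _ _ P n.+1)
  (@rdiff_exact _ _ P n) h0.
by exists h, h'.
Qed.

Lemma null_homotopy_colim n (x : colim (P n.+1)) :
  colim_nat (rdiff P n) x = 0 ->
  exists y, colim_nat (rdiff P n.+1) y = colim_nat (k n.+1) x.
Proof.
move=> dx; have [h [h' hE]] := null_homotopy n; exists (colim_nat h' x).
rewrite -colim_nat_comp.
rewrite (@colim_nat_ext _ _ _ _ (sub_nat (k n.+1) (comp_nat h (rdiff P n)))) //.
by rewrite colim_nat_sub colim_nat_comp dx raddf0 subr0.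
Qed.
End NullHomotopy.

(** With comparison maps f and g over the identity, 1 - g f lies over zero and is null homotopic. A
    cycle x is thus a boundary plus g (f x), and f x bounds in the colimit of [P]. *)
Lemma exact_colim_indep (C : smallcat) (M : abfunctor C) (P Q : resolution M) :
  exact_colim P -> exact_colim Q.
Proof.
move=> exP n x dx.
have [f] := comparison_exists (to_pull_idF (id_nat M)) Q P.
have [g] := comparison_exists (to_pull_idF (id_nat M)) P Q.
(* Comparison maps land in the pullback along [idF C]; they are retyped to be composable. *)
pose f' m : abnat (Q m) (P m) := @AbNat C (Q m) (P m) (f m) (@acomp_nat _ _ _ (f m)).
pose g' m : abnat (P m) (Q m) := @AbNat C (P m) (Q m) (g m) (@acomp_nat _ _ _ (g m)).
pose k m := sub_nat (id_nat (Q m)) (comp_nat (g' m) (f' m)).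
have k_aug c y : raug Q c (k 0%N c y) = 0.
  by rewrite /= raddfB (cmp_aug g) /= (cmp_aug f) subrr.
have k_diff m c y : rdiff Q m c (k m.+1 c y) = k m c (rdiff Q m c y).
  by rewrite /= raddfB (cmp_diff g) /= (cmp_diff f).
have [y yE] := null_homotopy_colim k_aug k_diff dx.
have dfx : colim_nat (rdiff P n) (colim_nat (f' n.+1) x) = 0.
  rewrite -colim_nat_comp (@colim_nat_ext _ _ _ _ (comp_nat (f' n) (rdiff Q n))).
    by rewrite colim_nat_comp dx raddf0.
  by move=> c z; exact: (cmp_diff f).
have [z zE] := exP _ _ dfx; exists (y + colim_nat (g' n.+2) z).
rewrite raddfD yE -[colim_nat _ (colim_nat _ z)]colim_nat_comp.
rewrite (@colim_nat_ext _ _ _ _ (comp_nat (g' n.+1) (rdiff P n.+1))).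
  by rewrite colim_nat_comp zE colim_nat_sub colim_nat_id colim_nat_comp subrK.
by move=> c t; exact: (cmp_diff g).
Qed.

(** * Criteria for vanishing derived colimits *)

Lemma projective_exact_colim (C : smallcat) (M : abfunctor C)
    (P : resolution M) :
  projective M -> exact_colim P.
Proof.
move=> prM n x dx.
have [s sE] := prM _ _ (raug P) (id_nat M) (@raug_epi _ _ P).
(* A section [s] of the augmentation makes this chain map lie over zero while it is the identity in
   positive degrees, where every cycle therefore bounds. *)
pose k m : abnat (P m) (P m) := match m return abnat (P m) (P m) with
  | 0 => sub_nat (id_nat (P 0%N)) (comp_nat s (raug P))
  | m.+1 => id_nat (P m.+1) end.
have k_aug c y : raug P c (k 0%N c y) = 0 by rewrite /= raddfB sE subrr.
have k_diff m c y : rdiff P m c (k m.+1 c y) = k m c (rdiff P m c y).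
  case: m y => //= y.
  have -> : raug P c (rdiff P 0 c y) = 0 by apply/raug_exact; exists y.
  by rewrite raddf0 subr0.
have [y yE] := null_homotopy_colim k_aug k_diff dx; exists y; rewrite yE.
exact: colim_nat_id.
Qed.

(** As for a representable functor, a map out of constant Z amounts to one element at [c0], spread
    along the arrows [i]; lifting the map means lifting that element. *)
Lemma initial_const_projective (C : smallcat) (c0 : C)
    (i : forall a, hom c0 a) :
  (forall a b (f : hom a b), compm f (i a) = i b) ->
  projective (const_ab C int).
Proof.
move=> iP M N u v uE; have [m mE] := uE c0 (v c0 1).
have wz c : zmod_morphism (fun n : int => ahom M (i c) m *~ n).
  by move=> x y; rewrite mulrzBr.
have wn a b (f : hom a b) (x : const_ab C int a) :
    mk_additive (wz b) x = ahom M f (mk_additive (wz a) x).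
  by rewrite /= raddfMz -ahom_comp iP.
exists (@AbNat C (const_ab C int) M (fun c => mk_additive (wz c)) wn) => c n /=.
by rewrite raddfMz acomp_nat mE -(acomp_nat v) /= -raddfMz intz.
Qed.

Lemma terminal_exact_colim (C : smallcat) (c1 : C) (t : forall a, hom a c1) :
  (forall a b (f : hom a b), compm (t b) f = t a) ->
  forall (M : abfunctor C) (P : resolution M), exact_colim P.
Proof.
move=> tP M P n x dx.
have kP (N : abfunctor C) a b (f : hom a b) x' :
    ahom N (t b) (ahom N f x') = ahom N (t a) x'.
  by rewrite -ahom_comp tP.
(* The colimit is identified with the value at [c1], where the resolution is exact. *)
pose q N : {additive colim N -> N c1} := colim_desc (kP N).
have q_inj N c z : q N (colim_inj N c z) = ahom N (t c) z.
  exact: colim_desc_inj.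
have qE N y : colim_inj N c1 (q N y) = y.
  apply: (colim_ext (f := colim_inj N c1 \o q N) (g := idfun)) => c z.
  rewrite -[LHS]/(colim_inj N c1 (q N (colim_inj N c z))) q_inj.
  exact: colim_inj_hom.
have : rdiff P n c1 (q _ x) = 0.
  rewrite -[RHS](raddf0 (q (P n))) -dx.
  apply: (colim_ext (f := rdiff P n c1 \o q _)
    (g := q (P n) \o colim_nat (rdiff P n))) => c z.
  rewrite -[LHS]/(rdiff P n c1 (q _ _)) -[RHS]/(q _ (colim_nat _ _)).
  by rewrite colim_nat_inj !q_inj acomp_nat.
move=> /(@rdiff_exact _ _ P)[y yE]; exists (colim_inj (P n.+2) c1 y).
by rewrite colim_nat_inj yE qE.
Qed.

Lemma pull_const (C D : smallcat) (F : functor D C) (V : zmodType) :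
  pull F (const_ab C V) = const_ab D V.
Proof. by congr AbFunctor; exact: Prop_irrelevance. Qed.

Lemma const_projective_retract (C D : smallcat) (H : functor C D)
    (K : functor D C) (V : zmodType) :
  compF K H = idF C -> projective (const_ab D V) -> projective (const_ab C V).
Proof.
move=> KH prV M N u v uE.
pose v' : abnat (const_ab D V) (pull K N) :=
  @AbNat D (const_ab D V) (pull K N) (fun d => v (K d))
    (fun a b f x => acomp_nat v (fhom K f) x).
have [|w wE] := prV _ _ (pull_nat K u) v'; first by move=> d y; exact: uE.
have w'n a b (f : hom a b) (x : const_ab C V a) :
    w (H b) x = ahom M (fhom K (fhom H f)) (w (H a) x).
  exact: (acomp_nat w (fhom H f) x).
(* Restricting along [H] gives values at [compF K H], equal to the identity only propositionally;
   generalizing over [E] turns the transport into a substitution. *)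
suff lift (E : functor C C) (eE : E = idF C)
    (w' : forall c, {additive V -> M (E c)}) :
    (forall a b (f : hom a b) x, w' b x = ahom M (fhom E f) (w' a x)) ->
    (forall c x, u (E c) (w' c x) = v (E c) x) ->
    exists t : abnat (const_ab C V) M, forall c x, u c (t c x) = v c x.
  exact: (lift _ KH (fun c => w (H c)) w'n (fun c => wE (H c))).
rewrite {}eE in w' * => w'nat w'E.
by exists (@AbNat C (const_ab C V) M w' w'nat).
Qed.

(** * The bar resolution *)

Lemma free_ab_ind (X : Type) (S : free_ab X -> Prop) :
  S 0 -> (forall x y, S x -> S y -> S (x - y)) ->
  (forall x, S (free_gen x)) -> forall x, S x.
Proof.
move=> S0 SB Sgen x.
have SC : GRing.zmod_closed ((fun y => `[< S y >]) : {pred free_ab X}).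
  split=> [|y z /asboolP Sy /asboolP Sz]; apply/asboolP; first exact: S0.
  exact: SB.
apply/asboolP; rewrite -[x]freeg_sumE.
apply: (@rpred_sum _ (mk_subgroup SC)) => z _.
rewrite -[coeff z x]intz -freegU_mulz.
by apply: (@rpredMz _ (mk_subgroup SC)); apply/asboolP; exact: Sgen.
Qed.

Section Bar.
Variable C : smallcat.

Definition string_push (n : nat) (a b : C) (f : hom a b) (s : string n.+1 a) :
    string n.+1 b :=
  let: existT d (t, g) := s in existT _ d (t, compm f g).

Lemma string_push_id n (a : C) (s : string n.+1 a) : string_push (idm a) s = s.
Proof. by case: s => d [t g]; rewrite /= comp_idl. Qed.

Lemma string_push_comp n (a b c : C) (g : hom b c) (f : hom a b)
    (s : string n.+1 a) :
  string_push (compm g f) s = string_push g (string_push f s).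
Proof. by case: s => d [t h]; rewrite /= comp_assoc. Qed.

Lemma string_del_push n j (a b : C) (f : hom a b) (s : string n.+2 a) :
  string_del j (string_push f s) = string_push f (string_del j s).
Proof.
by case: s => d [[e [u h]] g]; case: j => //; rewrite /= comp_assoc.
Qed.

Definition bar_hom n (a b : C) (f : hom a b) :
    {additive free_ab (string n.+1 a) -> free_ab (string n.+1 b)} :=
  free_lift (fun s => free_gen (string_push f s)).

Lemma bar_hom_id n (a : C) x : bar_hom n (idm a) x = x.
Proof.
apply: (free_ext (g := idfun)) => s.
by rewrite free_lift_gen string_push_id.
Qed.

Lemma bar_hom_comp n (a b c : C) (g : hom b c) (f : hom a b) x :
  bar_hom n (compm g f) x = bar_hom n g (bar_hom n f x).
Proof.
apply: (free_ext (g := bar_hom n g \o bar_hom n f)) => s.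
by rewrite -[RHS]/(bar_hom n g (bar_hom n f _)) !free_lift_gen string_push_comp.
Qed.

(* The direct sum of the representables Z[hom x_n -] over the simplices       *)
(* x_0 -> ... -> x_n of the nerve: its basis at c is the set of strings of    *)
(* n + 1 arrows ending at c.                                                  *)
Definition bar (n : nat) : abfunctor C :=
  AbFunctor (@bar_hom_id n) (@bar_hom_comp n).

(** The universal element of the summand Z[hom c -] indexed by [t]; on strings it also serves as the
    extra degeneracy in [bar_contract]. *)
Definition bar_top (n : nat) (c : C) (t : string n c) : string n.+1 c :=
  existT _ c (t, idm c).

Lemma bar_projective n : projective (bar n).
Proof.
move=> M N u v uE.
pose m (i : nerve C n) := projT1 (cid (uE (tag i) (v _ (free_gen (bar_top (tagged i)))))).
have mE (i : nerve C n) : u (tag i) (m i) = v _ (free_gen (bar_top (tagged i))).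
  exact: projT2 (cid (uE (tag i) (v _ (free_gen (bar_top (tagged i)))))).
pose wf c (s : string n.+1 c) : M c :=
  ahom M (tagged s).2 (m (existT _ (tag s) (tagged s).1)).
have wn a b (f : hom a b) x :
    free_lift (@wf b) (bar_hom n f x) = ahom M f (free_lift (@wf a) x).
  apply: (free_ext (f := free_lift (@wf b) \o bar_hom n f)
    (g := ahom M f \o free_lift (@wf a))) => -[d [t g]].
  rewrite -[LHS]/(free_lift _ (bar_hom n f _)) -[RHS]/(ahom M f (free_lift _ _)).
  by rewrite !free_lift_gen /wf /= ahom_comp.
exists (@AbNat C (bar n) M (fun c => free_lift (@wf c)) wn) => c x.
apply: (free_ext (f := u c \o free_lift (@wf c)) (g := v c)) => -[d [t g]].
rewrite -[LHS]/(u c (free_lift _ _)) free_lift_gen /wf /=.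
rewrite acomp_nat [u d _](mE (existT (string n) d t)) -(acomp_nat v) /=; congr (v c _).
by apply: (etrans (free_lift_gen _ _)); rewrite /= comp_idr.
Qed.

(** The end point [c] is never deleted, which makes the differential natural in [c]. *)
Definition bar_diff_comp n c : {additive bar n.+1 c -> bar n c} :=
  free_lift (fun s =>
    \sum_(i < n.+2) free_gen (string_del (n.+1 - i) s) *~ (-1) ^+ i).

Lemma bar_diff_nat n a b (f : hom a b) x :
  bar_diff_comp n b (ahom (bar n.+1) f x) = ahom (bar n) f (bar_diff_comp n a x).
Proof.
apply: (free_ext (f := bar_diff_comp n b \o ahom (bar n.+1) f)
  (g := ahom (bar n) f \o bar_diff_comp n a)) => s.
rewrite -[LHS]/(bar_diff_comp n b (bar_hom _ f _)).
rewrite -[RHS]/(bar_hom _ f (bar_diff_comp n a _)) !free_lift_gen raddf_sum.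
by apply: eq_bigr => i _; rewrite raddfMz free_lift_gen string_del_push.
Qed.

Definition bar_diff n : abnat (bar n.+1) (bar n) := AbNat (@bar_diff_nat n).

Lemma bar_diff_gen n c (s : string n.+2 c) : bar_diff n c (free_gen s) =
  \sum_(i < n.+2) free_gen (string_del (n.+1 - i) s) *~ (-1) ^+ i.
Proof. exact: free_lift_gen. Qed.

Lemma bar_diff_diff n c x : bar_diff n c (bar_diff n.+1 c x) = 0.
Proof.
apply: (free_ext (f := bar_diff n c \o bar_diff n.+1 c) (g := \0)) => s.
rewrite -[LHS]/(bar_diff n c (bar_diff n.+1 c _)) bar_diff_gen raddf_sum.
pose a i j := free_gen (string_del (n.+1 - j) (string_del (n.+2 - i) s)).
rewrite -[RHS](@alternating_cancel _ n.+2 a) => [|i j /andP[ji iN]]; last first.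
  have jn : (j <= n.+1)%N by exact: leq_trans ji iN.
  by rewrite /a subSS (subSn jn) string_del_del // leq_sub2l //= leq_subr.
by apply: eq_bigr => i _; rewrite raddfMz bar_diff_gen.
Qed.

Lemma bar_aug_nat a b (f : hom a b) x :
  (free_lift (fun=> 1) : {additive bar 0 b -> int}) (ahom (bar 0) f x) =
  (free_lift (fun=> 1) : {additive bar 0 a -> int}) x.
Proof.
apply: (free_ext (f := free_lift (fun=> 1) \o bar_hom 0 f)) => s.
rewrite -[LHS]/(free_lift _ (bar_hom 0 f _)).
by rewrite !free_lift_gen.
Qed.

Definition bar_aug : abnat (bar 0) (const_ab C int) :=
  @AbNat C (bar 0) (const_ab C int) (fun c => free_lift (fun=> 1)) bar_aug_nat.

Lemma bar_aug_gen c (s : string 1 c) : bar_aug c (free_gen s) = 1.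
Proof. exact: free_lift_gen. Qed.

(** A contraction for each [c] separately, with no naturality claimed: exactness in a functor
    category is objectwise. *)
Definition bar_contract n c : {additive bar n c -> bar n.+1 c} :=
  free_lift (fun s => free_gen (bar_top s)).

Lemma bar_contract_gen n c (s : string n.+1 c) :
  bar_contract n c (free_gen s) = free_gen (bar_top s).
Proof. exact: free_lift_gen. Qed.

Lemma string_del0_top n c (s : string n.+1 c) : string_del 0 (bar_top s) = s.
Proof. by case: s => d [t g]; rewrite /= comp_idl. Qed.

Lemma bar_contract0 c x :
  bar_diff 0 c (bar_contract 0 c x) =
  free_gen (bar_top (tt : string 0 c)) *~ bar_aug c x - x.
Proof.
have zl : zmod_morphism (fun x : bar 0 c =>
    (free_gen (bar_top (tt : string 0 c)) : bar 0 c) *~ bar_aug c x).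
  by move=> y z; rewrite raddfB mulrzBr.
apply: (free_ext (f := bar_diff 0 c \o bar_contract 0 c)
  (g := mk_additive zl \- idfun)) => s.
rewrite -[LHS]/(bar_diff 0 c (bar_contract 0 c _)) -[RHS]/(_ *~ _ - free_gen s).
rewrite bar_contract_gen bar_diff_gen bar_aug_gen !big_ord_recl big_ord0 addr0.
rewrite -[(1 - _)%N in X in _ + X]/0%N.
rewrite -[(1 - _)%N]/1%N string_del0_top mulr1z expr1.
by rewrite mulrN1z.
Qed.

Lemma bar_contractS n c x :
  bar_diff n.+1 c (bar_contract n.+1 c x) =
  bar_contract n c (bar_diff n c x) + x *~ (-1) ^+ n.+2.
Proof.
have zl : zmod_morphism (fun x : bar n.+1 c => x *~ (-1) ^+ n.+2).
  by move=> y z; rewrite mulrzBl.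
apply: (free_ext (f := bar_diff n.+1 c \o bar_contract n.+1 c)
  (g := (bar_contract n c \o bar_diff n c) \+ mk_additive zl)) => s.
rewrite -[LHS]/(bar_diff n.+1 c (bar_contract n.+1 c _)).
rewrite -[RHS]/(bar_contract n c (bar_diff n c _) + free_gen s *~ _).
rewrite bar_contract_gen !bar_diff_gen [LHS]big_ord_recr raddf_sum.
pose F j := free_gen (string_del j (bar_top s)).
congr (_ + _); last first.
  apply: (etrans (congr1 (fun j => F j *~ (-1) ^+ n.+2) (subnn n.+2))).
  by rewrite /F string_del0_top.
apply: eq_bigr => i _; rewrite raddfMz bar_contract_gen.
exact: (congr1 (fun j => F j *~ (-1) ^+ i) (subSn (leq_ord i))).
Qed.

Lemma bar_aug_epi : epi bar_aug.
Proof.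
move=> c n; exists (free_gen (bar_top (tt : string 0 c)) *~ n).
by rewrite raddfMz bar_aug_gen intz.
Qed.

Lemma bar_aug_exact c : exact_at 0 (bar_diff 0 c) (bar_aug c).
Proof.
move=> x; split=> [ax|[y <-]].
  by exists (- bar_contract 0 c x); rewrite raddfN bar_contract0 ax mulr0z sub0r opprK.
apply: (free_ext (f := bar_aug c \o bar_diff 0 c) (g := \0)) => s.
rewrite -[LHS]/(bar_aug c (bar_diff 0 c _)) bar_diff_gen.
by rewrite !big_ord_recl big_ord0 addr0 raddfD !raddfMz !bar_aug_gen.
Qed.

Lemma bar_exact n c : exact_at 0 (bar_diff n.+1 c) (bar_diff n c).
Proof.
move=> x; split=> [dx|[y <-]]; last exact: bar_diff_diff.
exists (bar_contract n.+1 c x *~ (-1) ^+ n.+2).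
rewrite raddfMz bar_contractS dx raddf0 add0r -mulrzA -exprD -signr_odd.
by rewrite oddD addbb mulr1z.
Qed.

Definition bar_resolution : resolution (const_ab C int) :=
  @Resolution C (const_ab C int) bar bar_diff bar_aug
    bar_projective bar_aug_epi bar_aug_exact bar_exact.

(** * The colimit of the bar resolution and the chains of the nerve *)

Definition bar_coinv n c : {additive bar n c -> free_ab (nerve C n)} :=
  free_lift (fun s => free_gen (existT _ (tag s) (tagged s).1 : nerve C n)).

Lemma bar_coinv_gen n c (s : string n.+1 c) : bar_coinv n c (free_gen s) =
  free_gen (existT _ (tag s) (tagged s).1 : nerve C n).
Proof. exact: free_lift_gen. Qed.

Lemma bar_coinv_hom n a b (f : hom a b) x :
  bar_coinv n b (ahom (bar n) f x) = bar_coinv n a x.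
Proof.
apply: (free_ext (f := bar_coinv n b \o bar_hom n f)) => -[d [t g]].
rewrite -[LHS]/(bar_coinv n b (bar_hom n f _)).
by rewrite free_lift_gen !bar_coinv_gen.
Qed.

Definition colim_to_nerve n : {additive colim (bar n) -> free_ab (nerve C n)} :=
  colim_desc (@bar_coinv_hom n).

Lemma colim_to_nerve_inj n c x :
  colim_to_nerve n (colim_inj (bar n) c x) = bar_coinv n c x.
Proof. exact: colim_desc_inj. Qed.

Definition nerve_to_colim n : {additive free_ab (nerve C n) -> colim (bar n)} :=
  free_lift (fun i => colim_inj (bar n) (tag i) (free_gen (bar_top (tagged i)))).

Lemma nerve_to_colim_gen n i : nerve_to_colim n (free_gen i) =
  colim_inj (bar n) (tag i) (free_gen (bar_top (tagged i))).
Proof. exact: free_lift_gen. Qed.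

(** With the two compatibilities with the differentials below, this makes the nerve chains a retract
    of the colimit complex, so exactness passes to them. *)
Lemma nerve_to_colimK n x : colim_to_nerve n (nerve_to_colim n x) = x.
Proof.
apply: (free_ext (f := colim_to_nerve n \o nerve_to_colim n) (g := idfun)) => -[c t].
rewrite -[LHS]/(colim_to_nerve n (nerve_to_colim n _)) nerve_to_colim_gen.
by rewrite colim_to_nerve_inj bar_coinv_gen.
Qed.

Lemma colim_inj_gen n c (s : string n.+1 c) :
  colim_inj (bar n) c (free_gen s) =
  nerve_to_colim n (free_gen (existT _ (tag s) (tagged s).1)).
Proof.
case: s => d [t g]; rewrite nerve_to_colim_gen -(colim_inj_hom g).
apply: (congr1 (colim_inj (bar n) c)); apply/esym.
by apply: (etrans (free_lift_gen _ _)); rewrite /= comp_idr.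
Qed.

(** Deleting the vertex next to [c] only alters the last arrow's source and the arrow itself; once
    that arrow is forgotten, what remains is the last face of the simplex. *)
Lemma string_del_nerve n j c (s : string n.+2 c) :
  existT _ (tag (string_del j s)) (tagged (string_del j s)).1 =
  nerve_del j (existT _ (tag s) (tagged s).1 : nerve C n.+1).
Proof. by case: s => d [[e [u h]] g]; case: j. Qed.

Lemma nerve_to_colim_diff n x :
  nerve_to_colim n (nerve_diff C n x) =
  colim_nat (bar_diff n) (nerve_to_colim n.+1 x).
Proof.
apply: (free_ext (f := nerve_to_colim n \o nerve_diff C n)
  (g := colim_nat (bar_diff n) \o nerve_to_colim n.+1)) => -[c t].
rewrite -[LHS]/(nerve_to_colim n (nerve_diff C n _)).
rewrite -[RHS]/(colim_nat _ (nerve_to_colim n.+1 _)) nerve_to_colim_gen.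
rewrite colim_nat_inj bar_diff_gen free_lift_gen !raddf_sum.
apply: eq_bigr => i _.
by rewrite !raddfMz colim_inj_gen string_del_nerve.
Qed.

Lemma colim_to_nerve_diff n x :
  colim_to_nerve n (colim_nat (bar_diff n) x) =
  nerve_diff C n (colim_to_nerve n.+1 x).
Proof.
apply: (colim_ext (f := colim_to_nerve n \o colim_nat (bar_diff n))
  (g := nerve_diff C n \o colim_to_nerve n.+1)) => c y.
rewrite -[LHS]/(colim_to_nerve n (colim_nat _ _)).
rewrite -[RHS]/(nerve_diff C n (colim_to_nerve n.+1 _)).
rewrite colim_nat_inj !colim_to_nerve_inj.
apply: (free_ext (f := bar_coinv n c \o bar_diff n c)
  (g := nerve_diff C n \o bar_coinv n.+1 c)) => s.
rewrite -[LHS]/(bar_coinv n c (bar_diff n c _)).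
rewrite -[RHS]/(nerve_diff C n (bar_coinv n.+1 c _)).
rewrite bar_diff_gen bar_coinv_gen free_lift_gen raddf_sum.
by apply: eq_bigr => i _; rewrite raddfMz bar_coinv_gen string_del_nerve.
Qed.

Lemma nerve_exact n x : exact_colim bar_resolution ->
  nerve_diff C n x = 0 -> exists y, nerve_diff C n.+1 y = x.
Proof.
move=> ex dx; have [|y yE] := ex n (nerve_to_colim n.+1 x).
  by rewrite -nerve_to_colim_diff dx raddf0.
by exists (colim_to_nerve n.+2 y); rewrite -colim_to_nerve_diff yE nerve_to_colimK.
Qed.

Lemma connected_nerve_exact0 (x : free_ab (nerve C 0)) : connected C ->
  nerve_aug C x = 0 -> exists y, nerve_diff C 0 y = x.
Proof.
move=> [[c0] conn] ax.
pose pt c : free_ab (nerve C 0) := free_gen (existT (string 0) c tt).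
have ptE (a b : C) : exists y, nerve_diff C 0 y = pt b - pt a.
  elim: (conn a b) => {a b}[a b [f]|a|a b _ [y yE]|a b c _ [y yE] _ [z zE]].
  - exists (free_gen (existT (string 1) b (existT _ a (tt, f)))).
    by rewrite free_lift_gen !big_ord_recl big_ord0 addr0.
  - by exists 0; rewrite raddf0 subrr.
  - by exists (- y); rewrite raddfN yE opprB.
  - by exists (y + z); rewrite raddfD yE zE addrC addrA subrK.
(* Subtracting the augmentation times a base point gives a claim valid for every chain, hence
   provable on generators. *)
suff [y yE] : exists y, nerve_diff C 0 y = x - pt c0 *~ nerve_aug C x.
  by exists y; rewrite yE ax mulr0z subr0.
elim/free_ab_ind: x {ax} => [|x x' [y yE] [y' y'E]|[c []]].
- by exists 0; rewrite (raddf0 (nerve_diff C 0)) (raddf0 (nerve_aug C)) mulr0z subr0.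
- by exists (y - y'); rewrite raddfB yE y'E (raddfB (nerve_aug C)) mulrzBr !opprD !opprK addrACA.
- by rewrite free_lift_gen; exact: ptE.
Qed.

Lemma reduced_homology_trivial : connected C ->
  acyclic (const_ab C int) -> ~ nontrivial_reduced_homology C.
Proof.
move=> conn /acyclic_exact_colim/(@exact_colim_indep _ _ _ bar_resolution) ex.
move=> [n [z]]; apply; move: z; apply: (homology_eq0 _ n).2.
(* Degrees are raised by one: the cases are reduced homology in degree -1 ([C] is inhabited), 0 ([C]
   is connected) and positive degrees (the bar resolution). *)
case: n => [|[|n]] x dx.
- have [c0] := conn.1; exists (free_gen (existT (string 0) c0 tt) *~ x).
  by rewrite raddfMz free_lift_gen intz.
- exact: connected_nerve_exact0.
- exact: nerve_exact.
Qed.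
End Bar.

(** * The group of integers *)

Lemma int_cat_connected : connected int_cat.
Proof. by split=> [|[] []]; [split; exact: tt | exact: rst_refl]. Qed.

Lemma int_cat_reduced_homology : nontrivial_reduced_homology int_cat.
Proof.
pose phi : {additive free_ab (nerve int_cat 1) -> int} :=
  free_lift (fun i => (tagged (tagged i)).2).
have phi_diff y : phi (nerve_diff int_cat 1 y) = 0.
  apply: (free_ext (f := phi \o nerve_diff int_cat 1) (g := \0)).
  move=> [c [b [[a [t g]] f]]].
  rewrite -[LHS]/(phi (nerve_diff int_cat 1 _)) free_lift_gen.
  rewrite !big_ord_recl big_ord0 addr0 !raddfD !raddfMz !free_lift_gen /=.
  by rewrite expr0 expr1 sqrrN expr1n !mulr1z mulrN1z opprD -addrA addNr addr0 subrr.
pose z : free_ab (nerve int_cat 1) :=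
  free_gen (existT (string 1) (tt : int_cat) (existT _ tt (tt, 1))).
have dz : cdiff_from (aug_nerve int_cat) 2 z = 0.
  rewrite -[LHS]/(nerve_diff int_cat 0 z) free_lift_gen.
  by rewrite !big_ord_recl big_ord0 addr0 mulr1z mulrN1z subrr.
exists 2%N; apply: contrapT => H.
have /homology_eq0/(_ z dz)[y yE] : forall w : homology (aug_nerve int_cat) 2, w = 0.
  by move=> w; apply: contrapT => w0; apply: H; exists w.
(* If [z] bounded, [phi z] would be 0, but it is 1. *)
by move: (phi_diff y); rewrite [nerve_diff _ _ _]yE free_lift_gen.
Qed.

(** * The Mayer-Vietoris sequence *)

Lemma add_initial_const_acyclic (C : smallcat) :
  acyclic (const_ab (add_initial C) int).
Proof.
apply/acyclic_exact_colim/projective_exact_colim.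
exact: (@initial_const_projective (add_initial C) None (fun=> tt)).
Qed.

Lemma add_terminal_acyclic (C : smallcat) (M : abfunctor (add_terminal C)) :
  acyclic M.
Proof.
apply/acyclic_exact_colim.
apply: (@terminal_exact_colim (add_terminal C) None
  (fun a => match a return terminal_hom a None with
            | Some b => tt | None => tt end)).
by move=> [a|] [b|].
Qed.

Lemma pushout_const_acyclic (C0 C : smallcat)
    (J1 : functor (add_initial C0) C) (J2 : functor (add_terminal C0) C) :
  connected C0 -> is_pushout (initial_incl C0) (terminal_incl C0) J1 J2 ->
  acyclic (const_ab C int).
Proof.
move=> conn po; apply/acyclic_exact_colim/projective_exact_colim.
have [K [K1 K2]] := pushout_desc_exists conn (pushout_comm po).
have po' := add_initial_terminal_pushout conn.
have [H [[H1 H2] _]] := pushout_univ po (pushout_comm po').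
(* Both sides restrict to [J1] and [J2], so uniqueness for the pushout [C] identifies them. *)
have KH : compF K H = idF C.
  have [I [_ I_uniq]] := pushout_univ po (pushout_comm po).
  rewrite -(I_uniq (idF C)); last by split; apply: functor_ext.
  apply/esym/I_uniq; split; [rewrite -[RHS]K1 -H1 | rewrite -[RHS]K2 -H2];
    exact: functor_ext.
apply: (const_projective_retract KH).
pose bot : add_terminal (add_initial C0) := Some None.
pose i a : hom bot a := match a return terminal_hom bot a with
  | Some _ => tt | None => tt end.
by apply: (initial_const_projective (i := i)) => -[a|] [b|].
Qed.

Lemma mayer_vietoris_acyclic (C0 C1 C2 C : smallcat)
    (F1 : functor C0 C1) (F2 : functor C0 C2)
    (J1 : functor C1 C) (J2 : functor C2 C)
    (comm : compF J1 F1 = compF J2 F2) (M : abfunctor C) :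
  acyclic (pull J1 M) -> acyclic (pull J2 M) -> acyclic M ->
  has_mayer_vietoris comm M -> acyclic (pull (compF J1 F1) M).
Proof.
move=> ac1 ac2 ac [d [ex _ _ _]] n x.
(* In degree [n.+1] the two middle components vanish, so [x] is the boundary of a class in degree
   [n.+2] over [C], which is zero. *)
have /ex[y <-] : mv_left comm x = 0.
  by rewrite /mv_left [colimn_map _ _ x]ac1 [X in - X]ac2 oppr0.
by rewrite [y]ac raddf0.
Qed.

Lemma no_mayer_vietoris (C0 : smallcat) :
  connected C0 -> nontrivial_reduced_homology C0 ->
  forall (C : smallcat)
    (J1 : functor (add_initial C0) C) (J2 : functor (add_terminal C0) C)
    (po : is_pushout (initial_incl C0) (terminal_incl C0) J1 J2),
  ~ has_mayer_vietoris (pushout_comm po) (const_ab C int).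
Proof.
move=> conn nt C J1 J2 po mv; apply: (reduced_homology_trivial conn _ nt).
rewrite -(pull_const (compF J1 (initial_incl C0)) int).
apply: mayer_vietoris_acyclic mv; last exact: pushout_const_acyclic conn po.
  by rewrite pull_const; exact: add_initial_const_acyclic.
exact: add_terminal_acyclic.
Qed.

Theorem mainTheorem2 :
  (forall (C0 : smallcat),
     connected C0 -> nontrivial_reduced_homology C0 ->
   forall (C : smallcat)
     (J1 : functor (add_initial C0) C) (J2 : functor (add_terminal C0) C)
     (po : is_pushout (initial_incl C0) (terminal_incl C0) J1 J2),
     ~ has_mayer_vietoris (pushout_comm po) (const_ab C int)) /\
  (connected int_cat /\ nontrivial_reduced_homology int_cat) /\
  ~ (forall (C0 C1 C2 C : smallcat)
       (F1 : functor C0 C1) (F2 : functor C0 C2)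
       (J1 : functor C1 C) (J2 : functor C2 C)
       (po : is_pushout F1 F2 J1 J2),
       injective_functor F1 -> injective_functor F2 ->
       injective_functor J1 -> injective_functor J2 ->
     forall M : abfunctor C, has_mayer_vietoris (pushout_comm po) M).
Proof.
split; first exact: no_mayer_vietoris.
split; first by split; [exact: int_cat_connected | exact: int_cat_reduced_homology].
(* The explicit model supplies an actual pushout square of injective functors for the group of
   integers. *)
move=> H; pose po := add_initial_terminal_pushout int_cat_connected.
apply: (no_mayer_vietoris int_cat_connected int_cat_reduced_homology (po := po)).
by apply: H; try exact: add_initial_terminal_incl_injective;
  split=> [a b []|a b f g].
Qed.
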